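(* Let $\tau\in(0,1)$ and $k\ge1$, and define $$\alpha_k^\tau=\sup_{0\le s\le1}\Big(s-\frac{s}{\tau}+\frac{\mathbb{E}[\min\{\mathrm{Pois}(sk),k\}]}{\tau k}\Big).$$ For every $\tau$-bounded simultaneous offering instance $I$ with $k$ positions there is $s\in[0,1]$ with $R_{\mathsf{ALG}^{s}_{\mathtt{sim}}}(I)\ge\alpha_k^\tau\,\mathrm{LP}_{\mathtt{sim}}(I)$; since $\mathsf{ALG}^s_{\mathtt{sim}}$ randomizes between two value-ordered policies, the best value-ordered policy has expected reward at least $\alpha_k^\tau\,\mathsf{OPT}_{\mathtt{sim}}(I)$.
   Context: Simultaneous offering problem: integers $1\le k\le n$; candidates with acceptance probabilities $p_i\in[0,1]$ and values $v_i\ge0$, labeled $v_1\ge\cdots\ge v_n$; a policy sends offers simultaneously to a (possibly random) set $S$; acceptances independent with probabilities $p_i$; reward $\sum_{i\in A}v_i-\max\{|A|-k,0\}$ for acceptor set $A$; $R_\pi(I)$ expected reward, $\mathsf{OPT}_{\mathtt{sim}}(I)$ its maximum. Value-ordered policy: offers to $S=\{1,\dots,m\}$ for some $m$. $\tau$-bounded: $v_i\ge\tau$ for all $i$. $V_{\mathrm{high}}=\{i:v_i>1\}$. $\mathrm{LP}_{\mathtt{sim}}(I)$: maximize $\sum_iv_ip_iy_i+z$ s.t. $z\le k-\sum_ip_iy_i$, $z\le0$, $0\le y_i\le1$. $\mathsf{ALG}^s_{\mathtt{sim}}$: take an optimal prefix-form solution $y$ of $\mathrm{LP}_{\mathtt{sim}}$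 ($y_i=1$ for $i<j$, $0$ for $i>j$) with total mass $\sum_iy_ip_i$ equal to $\min\{k,\sum_ip_i\}$ if $\sum_{i\in V_{\mathrm{high}}}p_i\le k$ and to $\sum_{i\in V_{\mathrm{high}}}p_i$ otherwise; set $\kappa=s\sum_iy_ip_i$, take $y'=(1,\dots,1,\theta,0,\dots,0)$ with $\sum_iy'_ip_i=\kappa$, and offer to each $i$ independently with probability $y'_i$. *)

(* Defs.v *)
From HB Require Import structures.
From mathcomp Require Import all_boot all_order all_algebra.
From mathcomp Require Import all_classical all_reals.
From mathcomp Require Import all_analysis.
Set Implicit Arguments. Unset Strict Implicit. Unset Printing Implicit Defensive.
Import Order.TTheory GRing.Theory Num.Theory numFieldNormedType.Exports.
Local Open Scope ring_scope.
Local Open Scope classical_set_scope.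

Section SimOffering.
Variable R : realType.

Definition E_min_pois (lam : R) (k : nat) : R :=
  limn (fun N : nat => \sum_(j < N) ((minn j k)%:R * (expR (- lam) * lam ^+ j / (j`!)%:R))).

Definition alpha (tau : R) (k : nat) : R :=
  sup [set (s - s / tau + E_min_pois (s * k%:R) k / (tau * k%:R)) | s in [set s : R | 0 <= s <= 1]].

Variable n : nat.

Definition reward (k : nat) (v : 'I_n -> R) (A : {set 'I_n}) : R :=
  \sum_(i in A) v i - Num.max (#|A|%:R - k%:R) 0.

(* probability that the acceptor set is exactly A, when offers are sent to S *)
Definition acc_prob (p : 'I_n -> R) (S A : {set 'I_n}) : R :=
  if A \subset S then \prod_(i in A) p i * \prod_(i in S :\: A) (1 - p i) else 0.

Definition reward_set (k : nat) (p v : 'I_n -> R) (S : {set 'I_n}) : R :=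
  \sum_(A : {set 'I_n}) acc_prob p S A * reward k v A.

(* a (possibly random) policy = a probability distribution on offer sets *)
Definition is_policy (pi : {set 'I_n} -> R) : Prop :=
  (forall S, 0 <= pi S) /\ \sum_(S : {set 'I_n}) pi S = 1.

Definition policy_reward (k : nat) (p v : 'I_n -> R) (pi : {set 'I_n} -> R) : R :=
  \sum_(S : {set 'I_n}) pi S * reward_set k p v S.

Definition OPT_sim (k : nat) (p v : 'I_n -> R) : R :=
  sup [set policy_reward k p v pi | pi in is_policy].

(* value-ordered policy: offer to {1,...,m} (here 0-indexed: {i | i < m}) *)
Definition prefix_set (m : nat) : {set 'I_n} := [set i : 'I_n | (i < m)%N].

Definition LP_feasible (k : nat) (p : 'I_n -> R) (yz : ('I_n -> R) * R) : Prop :=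
  [/\ forall i, 0 <= yz.1 i <= 1,
      yz.2 <= k%:R - \sum_i p i * yz.1 i & yz.2 <= 0].

Definition LP_sim (k : nat) (p v : 'I_n -> R) : R :=
  sup [set \sum_i v i * p i * yz.1 i + yz.2 | yz in LP_feasible k p].

Definition prefix_form (y : 'I_n -> R) : Prop :=
  exists (j : 'I_n) (theta : R), 0 <= theta <= 1 /\
    forall i : 'I_n, y i = (if (i < j)%N then 1 else if i == j then theta else 0).

(* total LP mass used by ALG^s_sim (before scaling by s) *)
Definition alg_mass (k : nat) (p v : 'I_n -> R) : R :=
  let high := \sum_(i | v i > 1) p i in
  if high <= k%:R then Num.min k%:R (\sum_i p i) else high.

Definition indep_policy (y : 'I_n -> R) : {set 'I_n} -> R :=
  fun S => \prod_(i in S) y i * \prod_(i in ~: S) (1 - y i).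

(* y' is a valid choice of the scaled vector of ALG^s_sim *)
Definition alg_vector (k : nat) (p v : 'I_n -> R) (s : R) (y' : 'I_n -> R) : Prop :=
  prefix_form y' /\ \sum_i y' i * p i = s * alg_mass k p v.

End SimOffering.

(* Main.v *)
Require Import Defs.
From HB Require Import structures.
From mathcomp Require Import all_boot all_order all_algebra.
From mathcomp Require Import all_classical all_reals.
From mathcomp Require Import all_analysis.
From mathcomp Require Import finset ring lra.
Import Order.TTheory GRing.Theory Num.Theory numFieldNormedType.Exports.
Local Open Scope ring_scope.

(** Write g(x) = E[min(Pois(x), k)].  It vanishes at 0 and its derivative
    Pr[Pois(x) < k] is nonincreasing, so g is concave, nondecreasing and at
    most the identity.  Adding a candidate of acceptance probability q turns
    E[min(X, k)] into (1 - q) E[min(X, k)] + q (1 + E[min(X, k - 1)]); for a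
    Poisson X this is exactly the tangent line of g, whence by induction
    E[min(X, k)] >= g(E X) for every sum X of independent Bernoulli variables.

    The reward of an offer vector y is sum_i (v_i - 1) p_i y_i + E[min(X, k)].
    Let M be the LP mass.  If M <= k, an exchange argument gives that the prefix
    of mass s M collects value Q >= s LP, and Q >= tau s M because v >= tau; the
    bound follows from g(s M) >= (M / k) g(s k).  If M > k, then
    LP <= W + k with W the total excess of the values above 1, the prefix
    collects excess at least s W, and g(s M) >= g(s k).  The supremum defining
    alpha is attained by continuity, and OPT <= LP. *)

(** * The truncated Poisson mean as a concave function of its rate *)

Definition pois_pmf {R : realType} (j : nat) (x : R) : R :=
  expR (- x) * x ^+ j / (j`!)%:R.

(* The probability of [Pois(x) < k], not [<= k]. *)
Definition pois_cdf {R : realType} (k : nat) (x : R) : R :=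
  \sum_(j < k) pois_pmf j x.

(* E[min(Pois(x), k)], as the sum of the tails Pr[Pois(x) > i] for i < k. *)
Definition pois_trunc {R : realType} (k : nat) (x : R) : R :=
  \sum_(i < k) (1 - pois_cdf i.+1 x).

Lemma pois_pmf_ge0 {R : realType} (j : nat) (x : R) :
  0 <= x -> 0 <= pois_pmf j x.
Proof.
by move=> x0; rewrite /pois_pmf divr_ge0 ?mulr_ge0 ?expR_ge0 ?exprn_ge0.
Qed.

Lemma pois_cdf_ge0 {R : realType} (k : nat) (x : R) :
  0 <= x -> 0 <= pois_cdf k x.
Proof. by move=> x0; apply: sumr_ge0 => j _; exact: pois_pmf_ge0. Qed.

Lemma pois_cdfS0 {R : realType} (k : nat) : pois_cdf k.+1 (0 : R) = 1.
Proof.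
rewrite /pois_cdf big_ord_recl big1 => [|j _].
  by rewrite /pois_pmf oppr0 expR0 expr0 fact0 divr1 mulr1 addr0.
by rewrite /pois_pmf expr0n /= mulr0 mul0r.
Qed.

Lemma pois_trunc0 {R : realType} (k : nat) : pois_trunc k (0 : R) = 0.
Proof. by apply: big1 => i _; rewrite pois_cdfS0 subrr. Qed.

Lemma pois_truncS {R : realType} (k : nat) (x : R) :
  pois_trunc k.+1 x = pois_trunc k x + (1 - pois_cdf k.+1 x).
Proof. by rewrite /pois_trunc big_ord_recr. Qed.

Lemma is_derive_pois_pmfS {R : realType} (j : nat) (x : R) :
  is_derive x 1 (pois_pmf j.+1) (pois_pmf j x - pois_pmf j.+1 x).
Proof.
have jn0 : j.+1%:R != 0 :> R by rewrite pnatr_eq0.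
have jf : (j`!)%:R != 0 :> R by rewrite pnatr_eq0 -lt0n fact_gt0.
have d : is_derive x 1 (fun z : R => expR (- z)) (- expR (- x)).
  apply: (is_derive_eq (@is_derive1_comp R expR -%R x _ _ _ _)).
  by rewrite [LHS]mulrN1.
(* Written as a product of functions with registered derivatives, the mass is differentiated by
   instance resolution. *)
have -> : @pois_pmf R j.+1 =
  cst (j.+1)`!%:R^-1 * ((fun z => expR (- z)) * (id ^+ j.+1)).
  by apply/funext => z; rewrite /pois_pmf !fctE mulrC.
apply: is_derive_eq.
rewrite /pois_pmf !fctE /= factS natrM /GRing.scale /= !exprS.
by field; rewrite jf -natr1 in jn0 *; rewrite addrC.
Qed.

(** Each mass has as derivative its predecessor minus itself, so the sum telescopes and only the
    last mass survives. *)
Lemma is_derive_pois_cdfS {R : realType} (k : nat) (x : R) :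
  is_derive x 1 (pois_cdf k.+1) (- pois_pmf k x).
Proof.
elim: k => [|k IH].
  have -> : @pois_cdf R 1 = expR \o -%R.
    apply/funext => z.
    by rewrite /pois_cdf big_ord1 /pois_pmf expr0 fact0 divr1 mulr1.
  apply: (is_derive_eq (@is_derive1_comp R expR -%R x _ _ _ _)).
  by rewrite [LHS]mulrN1 /pois_pmf expr0 fact0 divr1 mulr1.
have -> : @pois_cdf R k.+2 = pois_cdf k.+1 + pois_pmf k.+1.
  by apply/funext => z; rewrite /pois_cdf big_ord_recr.
apply: (is_derive_eq (is_deriveD IH (is_derive_pois_pmfS k x))).
by ring.
Qed.

Lemma is_derive_pois_trunc {R : realType} (k : nat) (x : R) :
  is_derive x 1 (pois_trunc k) (pois_cdf k x).
Proof.
elim: k => [|k IH].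
  have -> : @pois_trunc R 0 = cst 0.
    by apply/funext => z; rewrite /pois_trunc big_ord0.
  by rewrite /pois_cdf big_ord0; exact: is_derive_cst.
have -> : @pois_trunc R k.+1 = pois_trunc k + (cst 1 - pois_cdf k.+1).
  by apply/funext => z; rewrite pois_truncS.
have h := is_deriveB (is_derive_cst (1 : R) x 1) (is_derive_pois_cdfS k x).
apply: (is_derive_eq (is_deriveD IH h)).
by rewrite /pois_cdf big_ord_recr /= sub0r opprK.
Qed.

Lemma is_derive_continuous {R : realType} (f df : R -> R) :
  (forall x : R, is_derive x 1 f (df x)) -> continuous f.
Proof.
move=> h x; apply/differentiable_continuous/derivable1_diffP.
by case: (h x).
Qed.

Lemma pois_cdf_nincr {R : realType} (k : nat) (x y : R) :
  0 <= x -> x <= y -> pois_cdf k y <= pois_cdf k x.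
Proof.
case: k => [|k] x0 xy; first by rewrite /pois_cdf !big_ord0.
have [||c] := @MVT_segment R (pois_cdf k.+1) (fun z => - pois_pmf k z) x y xy.
- by move=> z _; exact: is_derive_pois_cdfS.
- by apply: continuous_subspaceT;
    exact: (is_derive_continuous _ _ (is_derive_pois_cdfS k)).
rewrite in_itv /= => /andP[xc _] e.
rewrite -subr_le0 e mulNr oppr_le0 mulr_ge0 ?subr_ge0 //.
exact: pois_pmf_ge0 (le_trans x0 xc).
Qed.

(** Concavity in tangent form: the mean value theorem gives slope [pois_cdf k c] for some c between
    a and b, and monotonicity of [pois_cdf] compares it with the slope at b, in the right direction
    on either side of b. *)
Lemma pois_trunc_tangent {R : realType} (k : nat) (a b : R) :
  0 <= a -> 0 <= b ->
  pois_trunc k a <= pois_trunc k b + (a - b) * pois_cdf k b.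
Proof.
move=> a0 b0.
have cont (x y : R) : ({within `[x, y], continuous (@pois_trunc R k)})%classic.
  by apply: continuous_subspaceT;
    exact: (is_derive_continuous _ _ (is_derive_pois_trunc k)).
case: (leP a b) => [ab|/ltW ba].
- have [||c] := @MVT_segment R (pois_trunc k) (pois_cdf k) a b ab => //.
    by move=> z _; exact: is_derive_pois_trunc.
  rewrite in_itv /= => /andP[ac cb] e.
  have := pois_cdf_nincr k c b (le_trans a0 ac) cb.
  by nra.
- have [||c] := @MVT_segment R (pois_trunc k) (pois_cdf k) b a ba => //.
    by move=> z _; exact: is_derive_pois_trunc.
  rewrite in_itv /= => /andP[bc ca] e.
  have := pois_cdf_nincr k b c b0 bc.
  by nra.
Qed.

Lemma pois_trunc_le_id {R : realType} (k : nat) (x : R) :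
  0 <= x -> pois_trunc k x <= x.
Proof.
case: k => [|k] x0; first by rewrite /pois_trunc big_ord0.
have := pois_trunc_tangent k.+1 x 0 x0 (lexx 0).
by rewrite pois_trunc0 pois_cdfS0 add0r subr0 mulr1.
Qed.

Lemma pois_trunc_ndecr {R : realType} (k : nat) (x y : R) :
  0 <= x -> x <= y -> pois_trunc k x <= pois_trunc k y.
Proof.
move=> x0 xy; have y0 := le_trans x0 xy.
have := pois_trunc_tangent k x y x0 y0.
have := pois_cdf_ge0 k y y0; nra.
Qed.

(** Concavity along the chord from the origin. The tangent at t x is evaluated at x with weight t
    and at 0 with weight 1 - t; the slope terms cancel. *)
Lemma pois_trunc_scale {R : realType} (k : nat) (t x : R) :
  0 <= t <= 1 -> 0 <= x -> t * pois_trunc k x <= pois_trunc k (t * x).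
Proof.
move=> /andP[t0 t1] x0; have tx0 : 0 <= t * x by rewrite mulr_ge0.
have h1 := pois_trunc_tangent k x (t * x) x0 tx0.
have h0 := pois_trunc_tangent k 0 (t * x) (lexx 0) tx0.
have t1' : 0 <= 1 - t by rewrite subr_ge0.
have := ler_wpM2l t0 h1; have := ler_wpM2l t1' h0.
rewrite pois_trunc0; nra.
Qed.

(** * The series [E_min_pois] in closed form *)

Lemma sum_pois_pmf_cvg {R : realType} (x : R) :
  ((fun N : nat => \sum_(j < N) pois_pmf j x) @ \oo --> (1 : R))%classic.
Proof.
have -> : (fun N : nat => \sum_(j < N) pois_pmf j x)
  = (fun N : nat => expR (- x) * series (exp_coeff x) N).
  apply/funext => N; rewrite /series /= big_mkord mulr_sumr.
  by apply: eq_bigr => j _; rewrite /pois_pmf mulrA.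
have e : expR (- x) * expR x = 1 by rewrite mulrC expRxMexpNx_1.
suff : ((fun N : nat => expR (- x) * series (exp_coeff x) N) @ \oo
    --> expR (- x) * expR x)%classic by rewrite e.
apply: cvgMl_tmp.
exact: is_cvg_series_exp_coeff.
Qed.

(** Raising the cap from k to k + 1 adds one unit of weight to every j > k, that is, the total mass
    1 less [pois_cdf k.+1 x]. *)
Lemma sum_min_pois_cvg {R : realType} (k : nat) (x : R) :
  ((fun N : nat => \sum_(j < N) (minn j k)%:R * pois_pmf j x) @ \oo
    --> pois_trunc k x)%classic.
Proof.
elim: k => [|k IH].
  rewrite /pois_trunc big_ord0.
  have -> : (fun N : nat => \sum_(j < N) (minn j 0)%:R * pois_pmf j x)
      = fun=> 0.
    by apply/funext => N; apply: big1 => j _; rewrite minn0 mul0r.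
  exact: cvg_cst.
rewrite pois_truncS.
have h : ((fun N : nat => \sum_(j < N) (minn j k)%:R * pois_pmf j x +
    (\sum_(j < N) pois_pmf j x - pois_cdf k.+1 x)) @ \oo
    --> pois_trunc k x + (1 - pois_cdf k.+1 x))%classic.
  apply: cvgD IH _; apply: cvgB; first exact: sum_pois_pmf_cvg.
  exact: cvg_cst.
(* The two sequences need agree only for N > k, when the partial sum already contains all of
   [pois_cdf k.+1 x]. *)
apply: cvg_trans h; apply: near_eq_cvg; exists k.+1 => // N /= kN.
have -> : pois_cdf k.+1 x = \sum_(j < N | (j <= k)%N) pois_pmf j x.
  by rewrite /pois_cdf (big_ord_widen N (fun j => pois_pmf j x) kN).
rewrite (bigID (fun j : 'I_N => (j <= k)%N) _ (fun j => pois_pmf j x)) /=.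
rewrite addrAC subrr add0r [X in _ + X]big_mkcond -big_split /=.
apply: eq_bigr => j _; case: leqP => jk.
  by rewrite (minn_idPl (leqW jk)) addr0.
have -> : minn j k.+1 = k.+1 by apply/minn_idPr.
by rewrite -natr1 mulrDl mul1r.
Qed.

Lemma E_min_poisE {R : realType} (x : R) (k : nat) :
  E_min_pois x k = pois_trunc k x.
Proof. exact/cvg_lim/sum_min_pois_cvg. Qed.

(** * Expectations over the random acceptor set *)

Lemma finset_ind {T : finType} (P : {set T} -> Prop) :
  P set0 -> (forall (x : T) (A : {set T}), x \notin A -> P A -> P (x |: A)) ->
  forall A : {set T}, P A.
Proof.
move=> P0 PU A; move: {2}#|A| (erefl #|A|) => m.
elim: m A => [|m IH] A.
  by move/cards0_eq => ->.
move=> Am; have /card_gt0P[x xA] : (0 < #|A|)%N by rewrite Am.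
rewrite -(setD1K xA); apply: PU; first by rewrite !inE eqxx.
by apply: IH; move: Am; rewrite (cardsD1 x) xA add1n => -[].
Qed.

(** The test function [h] is arbitrary because conditioning on an acceptance by j replaces [h] with
    its shift by j. *)
Definition acc_expect {R : realType} {n : nat} (p : 'I_n -> R) (S : {set 'I_n})
    (h : {set 'I_n} -> R) : R :=
  \sum_(A : {set 'I_n}) acc_prob p S A * h A.

Lemma acc_prob_ge0 {R : realType} {n : nat} (p : 'I_n -> R) (S A : {set 'I_n}) :
  (forall i, 0 <= p i <= 1) -> 0 <= acc_prob p S A.
Proof.
move=> p01; rewrite /acc_prob; case: ifP => // _; apply: mulr_ge0.
  by apply: prodr_ge0 => i _; case/andP: (p01 i).
by apply: prodr_ge0 => i _; rewrite subr_ge0; case/andP: (p01 i).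
Qed.

Lemma acc_expect_le {R : realType} {n : nat} (p : 'I_n -> R) (S : {set 'I_n})
    (h h' : {set 'I_n} -> R) :
  (forall i, 0 <= p i <= 1) -> (forall A, h A <= h' A) ->
  acc_expect p S h <= acc_expect p S h'.
Proof.
move=> p01 hh'; apply: ler_sum => A _.
by apply: ler_wpM2l (hh' A); exact: acc_prob_ge0.
Qed.

Lemma eq_acc_expect {R : realType} {n : nat} (p : 'I_n -> R) (S : {set 'I_n})
    (h h' : {set 'I_n} -> R) :
  (forall A : {set 'I_n}, A \subset S -> h A = h' A) ->
  acc_expect p S h = acc_expect p S h'.
Proof.
move=> hh'; apply: eq_bigr => A _; rewrite /acc_prob.
by case: ifP => [AS|_]; [rewrite hh'|rewrite !mul0r].
Qed.

Lemma acc_expectD {R : realType} {n : nat} (p : 'I_n -> R) (S : {set 'I_n})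
    (h h' : {set 'I_n} -> R) :
  acc_expect p S (fun A => h A + h' A) = acc_expect p S h + acc_expect p S h'.
Proof. by rewrite -big_split; apply: eq_bigr => A _; rewrite mulrDr. Qed.

Lemma acc_expect0 {R : realType} {n : nat} (p : 'I_n -> R)
    (h : {set 'I_n} -> R) : acc_expect p set0 h = h set0.
Proof.
rewrite /acc_expect (bigD1 set0) //= big1 => [|A A0].
  by rewrite /acc_prob sub0set setD0 !big_set0 !mul1r addr0.
by rewrite /acc_prob subset0 (negbTE A0) mul0r.
Qed.

(** Conditioning on the answer of j, which is independent of the others. This recursion drives every
    later induction on the offer set. *)
Lemma acc_expectU1 {R : realType} {n : nat} (p : 'I_n -> R) (j : 'I_n)
    (S : {set 'I_n}) (h : {set 'I_n} -> R) : j \notin S ->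
  acc_expect p (j |: S) h =
    (1 - p j) * acc_expect p S h + p j * acc_expect p S (fun A => h (j |: A)).
Proof.
move=> jS; rewrite /acc_expect (bigID (fun A : {set 'I_n} => j \in A)) /=.
rewrite addrC; congr (_ + _).
- rewrite [in RHS](bigID (fun A : {set 'I_n} => j \in A)) /=.
  rewrite [X in _ = _ * (X + _)]big1 => [|A jA]; last first.
    by rewrite /acc_prob ifN ?mul0r //; apply/subsetPn; exists j.
  rewrite add0r mulr_sumr; apply: eq_bigr => A jA.
  rewrite mulrA; congr (_ * _); rewrite /acc_prob.
  have -> : (A \subset j |: S) = (A \subset S).
    by rewrite -subDset (setDidPl _) // disjoint_sym disjoints1.
  case: ifP => _; last by rewrite mulr0.
  rewrite setDUl (setDidPl _) ?disjoints1 // big_setU1 /=; last first.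
    by rewrite inE (negbTE jS) andbF.
  by rewrite mulrCA.
- rewrite [in RHS](bigID (fun A : {set 'I_n} => j \in A)) /=.
  rewrite [X in _ = _ * (X + _)]big1 => [|A jA]; last first.
    by rewrite /acc_prob ifN ?mul0r //; apply/subsetPn; exists j.
  rewrite add0r mulr_sumr.
  (* Acceptor sets containing j correspond to those avoiding it, by inserting and deleting j. *)
  rewrite (reindex_onto (fun A => j |: A) (fun A => A :\ j)) /=; last first.
    by move=> A; exact: setD1K.
  have e (A : {set 'I_n}) :
      (j \in j |: A) && ((j |: A) :\ j == A) = (j \notin A).
    rewrite setU11 /=; apply/eqP/idP => [<-|jA]; last exact: setU1K.
    by rewrite !inE eqxx.
  rewrite (eq_bigl _ _ e); apply: eq_bigr => A jA.
  rewrite mulrA; congr (_ * _); rewrite /acc_prob.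
  have -> : (j |: A \subset j |: S) = (A \subset S).
    rewrite subUset sub1set setU11 /=.
    by rewrite -subDset (setDidPl _) // disjoint_sym disjoints1.
  case: ifP => _; last by rewrite mulr0.
  rewrite big_setU1 //= mulrA; congr (_ * _); apply: eq_bigl => i.
  by rewrite !inE; case: eqP => // ->; rewrite (negbTE jS) andbF.
Qed.

Lemma acc_expect_cst {R : realType} {n : nat} (p : 'I_n -> R) (S : {set 'I_n})
    (c : R) : acc_expect p S (fun=> c) = c.
Proof.
elim/(@finset_ind 'I_n): S => [|j S jS IH]; first by rewrite acc_expect0.
by rewrite acc_expectU1 // IH; ring.
Qed.

Lemma acc_expect_sum {R : realType} {n : nat} (p w : 'I_n -> R)
    (S : {set 'I_n}) :
  acc_expect p S (fun A => \sum_(i in A) w i) = \sum_(i in S) w i * p i.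
Proof.
elim/(@finset_ind 'I_n): S => [|j S jS IH].
  by rewrite acc_expect0 !big_set0.
rewrite acc_expectU1 //.
rewrite [X in _ + _ * X](eq_acc_expect _ _ _
  (fun A => w j + \sum_(i in A) w i)); last first.
  move=> A AS; rewrite big_setU1 //.
  exact: contra (fintype.subsetP AS j) jS.
by rewrite acc_expectD acc_expect_cst IH big_setU1 //=; ring.
Qed.

Definition acc_min {R : realType} {n : nat} (p : 'I_n -> R) (k : nat)
    (S : {set 'I_n}) : R :=
  acc_expect p S (fun A => (minn #|A| k)%:R).

Lemma acc_min0 {R : realType} {n : nat} (p : 'I_n -> R) (S : {set 'I_n}) :
  acc_min p 0 S = 0.
Proof.
rewrite -[RHS](acc_expect_cst p S); apply: eq_acc_expect => A _.
by rewrite minn0.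
Qed.

(** An acceptance by j occupies one of the k + 1 positions and leaves k for the rest. *)
Lemma acc_minU1 {R : realType} {n : nat} (p : 'I_n -> R) (k : nat) (j : 'I_n)
    (S : {set 'I_n}) : j \notin S ->
  acc_min p k.+1 (j |: S) =
    (1 - p j) * acc_min p k.+1 S + p j * (1 + acc_min p k S).
Proof.
move=> jS; rewrite /acc_min acc_expectU1 //; congr (_ + _ * _).
rewrite -[X in X + _](acc_expect_cst p S 1) -acc_expectD.
apply: eq_acc_expect => A AS; have jA : j \notin A.
  exact: contra (fintype.subsetP AS j) jS.
by rewrite cardsU1 jA add1n minnSS -nat1r.
Qed.

Lemma acc_min_le {R : realType} {n : nat} (p : 'I_n -> R) (k : nat)
    (S : {set 'I_n}) : (forall i, 0 <= p i <= 1) -> acc_min p k S <= k%:R.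
Proof.
move=> p01; rewrite -[leRHS](acc_expect_cst p S); apply: acc_expect_le => // A.
by rewrite ler_nat geq_minr.
Qed.

Lemma acc_min_le_sum {R : realType} {n : nat} (p : 'I_n -> R) (k : nat)
    (S : {set 'I_n}) :
  (forall i, 0 <= p i <= 1) -> acc_min p k S <= \sum_(i in S) p i.
Proof.
move=> p01.
rewrite (_ : \sum_(i in S) p i = acc_expect p S (fun A => \sum_(i in A) 1)).
  by apply: acc_expect_le => // A; rewrite sumr_const ler_nat geq_minl.
by rewrite acc_expect_sum; apply: eq_bigr => i _; rewrite mul1r.
Qed.

(** * Comparison of Bernoulli sums with the Poisson law *)

(** By [pois_truncS], the coefficient of q on the right is [pois_cdf k.+1 x], so the right side is
    the tangent at x evaluated at x + q. *)
Lemma pois_trunc_mix {R : realType} (k : nat) (q x : R) :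
  0 <= q -> 0 <= x ->
  pois_trunc k.+1 (x + q) <=
    (1 - q) * pois_trunc k.+1 x + q * (1 + pois_trunc k x).
Proof.
move=> q0 x0; have := pois_trunc_tangent k.+1 (x + q) x (addr_ge0 x0 q0) x0.
by rewrite !pois_truncS; nra.
Qed.

(** [pois_trunc_mix] mirrors the recursion [acc_minU1]. The cap k stays general in the induction
    because the recursion lowers it. *)
Lemma acc_min_ge_pois {R : realType} {n : nat} (p : 'I_n -> R) (k : nat)
    (S : {set 'I_n}) : (forall i, 0 <= p i <= 1) ->
  pois_trunc k (\sum_(i in S) p i) <= acc_min p k S.
Proof.
move=> p01; elim/(@finset_ind 'I_n): S k => [|j S jS IH] k.
  by rewrite big_set0 pois_trunc0 /acc_min acc_expect0 ler0n.
case: k => [|k]; first by rewrite acc_min0 /pois_trunc big_ord0.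
rewrite acc_minU1 // big_setU1 //= addrC; have /andP[pj0 pj1] := p01 j.
have S0 : 0 <= \sum_(i in S) p i.
  by apply: sumr_ge0 => i _; case/andP: (p01 i).
apply: le_trans (pois_trunc_mix k _ _ pj0 S0) _.
by rewrite lerD // ler_wpM2l ?subr_ge0 ?lerD2l.
Qed.

(** Since a - max(a - k, 0) = min(a, k), charging every acceptance one unit makes the reward linear
    up to the truncated count. *)
Lemma reward_setE {R : realType} {n : nat} (k : nat) (p v : 'I_n -> R)
    (S : {set 'I_n}) :
  reward_set k p v S = \sum_(i in S) (v i - 1) * p i + acc_min p k S.
Proof.
rewrite -acc_expect_sum -acc_expectD; apply: eq_acc_expect => A _.
rewrite /reward sumrB sumr_const -addrA; congr (_ + _).
case: (leqP #|A| k) => h.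
  rewrite (max_idPr _) ?subr_le0 ?ler_nat // oppr0.
  by rewrite addrC subrr.
rewrite (max_idPl _) ?subr_ge0 ?ler_nat ?(ltnW h) //.
by rewrite opprB addrC.
Qed.

Lemma sum_mem_le {R : realType} {n : nat} (p : 'I_n -> R) (P : pred 'I_n) :
  (forall i, 0 <= p i <= 1) -> \sum_(i | P i) p i <= \sum_i p i.
Proof.
move=> p01; rewrite [leRHS](bigID P) /= lerDl.
by apply: sumr_ge0 => i _; case/andP: (p01 i).
Qed.

(** * Prefix vectors and the policies they induce *)

Definition prefix_vec {R : realType} {n : nat} (j : 'I_n) (theta : R)
    (i : 'I_n) : R :=
  if (i < j)%N then 1 else if i == j then theta else 0.

Lemma prefix_formP {R : realType} {n : nat} (y : 'I_n -> R) :
  prefix_form y <-> exists (j : 'I_n) (theta : R),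
    0 <= theta <= 1 /\ y = prefix_vec j theta.
Proof.
split=> -[j [theta [t01 e]]]; exists j, theta; split=> //.
  exact/funext.
by rewrite e.
Qed.

Lemma prefix_vec_itv {R : realType} {n : nat} (j : 'I_n) (theta : R)
    (i : 'I_n) : 0 <= theta <= 1 -> 0 <= prefix_vec j theta i <= 1.
Proof.
move=> t01; rewrite /prefix_vec; case: ifP => _; first by rewrite ler01 lexx.
by case: ifP => // _; rewrite ler01 lexx.
Qed.

Lemma prefix_setS {n : nat} (j : 'I_n) :
  prefix_set n j.+1 = j |: prefix_set n j.
Proof. by apply/setP => i; rewrite !inE ltnS leq_eqVlt. Qed.

Lemma prefix_set_self {n : nat} (j : 'I_n) : j \notin prefix_set n j.
Proof. by rewrite inE ltnn. Qed.

Lemma sum_prefix_vec {R : realType} {n : nat} (w : 'I_n -> R) (j : 'I_n)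
    (theta : R) :
  \sum_i w i * prefix_vec j theta i =
  \sum_(i in prefix_set n j) w i + theta * w j.
Proof.
rewrite (bigD1 j) //= addrC [in RHS]big_mkcond [in RHS](bigD1 j) //=.
rewrite inE ltnn add0r {2}/prefix_vec ltnn eqxx [w j * _]mulrC; congr (_ + _).
apply: eq_bigr => i ij; rewrite inE /prefix_vec (negbTE ij).
by case: ifP; rewrite ?mulr1 ?mulr0.
Qed.

(** Every coordinate other than j is 0 or 1, so the only randomness is whether j receives an
    offer. *)
Lemma indep_policy_prefix_vec {R : realType} {n : nat} (j : 'I_n) (theta : R)
    (S : {set 'I_n}) :
  indep_policy (prefix_vec j theta) S =
  if S == prefix_set n j.+1 then theta
  else if S == prefix_set n j then 1 - theta else 0.
Proof.
pose f i := if i \in S then prefix_vec j theta i else 1 - prefix_vec j theta i.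
have -> : indep_policy (prefix_vec j theta) S = \prod_i f i.
  rewrite /indep_policy !(big_mkcond (fun i => i \in _)) -big_split /=.
  apply: eq_bigr => i _; rewrite inE /f.
  by case: (i \in S); rewrite /= ?mulr1 ?mul1r.
have [h|] := boolP [forall i, (i != j) ==> ((i \in S) == (i < j)%N)].
  have {}h i : i != j -> (i \in S) = (i < j)%N.
    by move=> ij; move/forallP/(_ i): h; rewrite ij => /eqP.
  rewrite (bigD1 j) //= big1 ?mulr1 => [|i ij]; last first.
    rewrite /f /prefix_vec h // (negbTE ij).
    by case: ifP => ->; rewrite ?subr0.
  have neq : (prefix_set n j == prefix_set n j.+1) = false.
    apply/negbTE/eqP => /setP /(_ j).
    by rewrite !inE ltnn leqnn.
  rewrite /f {1 2}/prefix_vec ltnn eqxx; case: ifP => jS.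
    suff -> : S = prefix_set n j.+1 by rewrite eqxx.
    rewrite prefix_setS; apply/setP => i; rewrite !inE.
    by have [->|/h] := eqVneq i j.
  suff -> : S = prefix_set n j by rewrite neq eqxx.
  apply/setP => i; rewrite !inE.
  by have [->|/h] := eqVneq i j; rewrite ?ltnn.
(* Here S disagrees with the prefix at some i other than j, and the factor of i in the product is
   zero. *)
rewrite negb_forall => /existsP[i]; rewrite negb_imply => /andP[ij iS].
have -> : (S == prefix_set n j.+1) = false.
  apply/negbTE; apply/eqP => e; move: iS; rewrite e inE ltnS leq_eqVlt val_eqE.
  by rewrite (negbTE ij) eqxx.
have -> : (S == prefix_set n j) = false.
  by apply/negbTE; apply/eqP => e; move: iS; rewrite e inE eqxx.
rewrite (bigD1 i) //= {1}/f /prefix_vec (negbTE ij).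
by move: iS; case: (i \in S); case: (i < j)%N => //= _; rewrite ?subrr mul0r.
Qed.

Lemma policy_reward_prefix_vec {R : realType} {n : nat} (k : nat)
    (p v : 'I_n -> R) (j : 'I_n) (theta : R) :
  policy_reward k p v (indep_policy (prefix_vec j theta)) =
  theta * reward_set k p v (prefix_set n j.+1)
  + (1 - theta) * reward_set k p v (prefix_set n j).
Proof.
have neq : prefix_set n j != prefix_set n j.+1.
  by apply/eqP => /setP /(_ j); rewrite !inE ltnn leqnn.
rewrite /policy_reward (bigD1 (prefix_set n j.+1)) //=.
rewrite (bigD1 (prefix_set n j)) //= big1 => [|S /andP[S1 S0]].
  by rewrite !indep_policy_prefix_vec !eqxx (negbTE neq) addr0.
by rewrite indep_policy_prefix_vec (negbTE S1) (negbTE S0) mul0r.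
Qed.

(** An offer to j made with probability theta acts as a Bernoulli variable of parameter theta p_j,
    so one more use of [pois_trunc_mix] on top of the full prefix suffices. *)
Lemma policy_reward_prefix_vec_ge {R : realType} {n : nat} (k : nat)
    (p v : 'I_n -> R) (j : 'I_n) (theta : R) :
  (forall i, 0 <= p i <= 1) -> 0 <= theta <= 1 ->
  \sum_i (v i - 1) * p i * prefix_vec j theta i
  + pois_trunc k (\sum_i p i * prefix_vec j theta i)
  <= policy_reward k p v (indep_policy (prefix_vec j theta)).
Proof.
move=> p01 /andP[t0 t1]; rewrite policy_reward_prefix_vec !sum_prefix_vec.
rewrite !reward_setE prefix_setS big_setU1 ?prefix_set_self //=.
set W := \sum_(i in _) _; set S := prefix_set n j.
set X := \sum_(i in S) p i; have /andP[pj0 pj1] := p01 j.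
have X0 : 0 <= X by apply: sumr_ge0 => i _; case/andP: (p01 i).
suff : pois_trunc k (X + theta * p j) <=
    theta * acc_min p k (j |: S) + (1 - theta) * acc_min p k S by lra.
case: k => [|k]; first by rewrite !acc_min0 /pois_trunc big_ord0 !mulr0 addr0.
rewrite acc_minU1 ?prefix_set_self //.
have q0 : 0 <= theta * p j by rewrite mulr_ge0.
have q1 : 0 <= 1 - theta * p j by rewrite subr_ge0 mulr_ile1.
apply: le_trans (pois_trunc_mix k _ _ q0 X0) _.
have := ler_wpM2l q1 (acc_min_ge_pois p k.+1 S p01).
have := ler_wpM2l q0 (acc_min_ge_pois p k S p01).
rewrite -/X; lra.
Qed.

(* Both factors of (w i - w j) * (p i * q i - x i) change sign at the
   fractional index j of the prefix q. *)
Lemma prefix_vec_exchange {R : realType} {n : nat} (w p x : 'I_n -> R)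
    (j : 'I_n) (theta : R) :
  (forall i i' : 'I_n, (i <= i')%N -> w i' <= w i) ->
  (forall i, 0 <= x i <= p i) ->
  \sum_i w i * x i
  + w j * (\sum_i p i * prefix_vec j theta i - \sum_i x i)
  <= \sum_i w i * p i * prefix_vec j theta i.
Proof.
move=> wdec xp; rewrite -sumrB mulr_sumr -big_split /=.
apply: ler_sum => i _; have /andP[x0 xpi] := xp i.
rewrite /prefix_vec; case: (ltngtP i j) => [ij|ji|/val_inj ->].
- have := wdec i j (ltnW ij); nra.
- rewrite ifN; last by apply/eqP => e; rewrite e ltnn in ji.
  have := wdec j i (ltnW ji); nra.
- by rewrite eqxx; lra.
Qed.

Lemma prefix_vec_exists {R : realType} {n : nat} (p : 'I_n -> R) (t : R) :
  (0 < n)%N -> 0 <= t <= \sum_i p i ->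
  exists (j : 'I_n) (theta : R), 0 <= theta <= 1 /\
    \sum_i p i * prefix_vec j theta i = t.
Proof.
move=> n0 /andP[t0 tp]; pose F m := \sum_(i in prefix_set n m) p i.
have F0 : F 0%N = 0 by apply: big1 => i; rewrite inE.
have Fn : t <= F n.
  by apply: le_trans tp _; rewrite le_eqVlt; apply/orP; left; apply/eqP;
    apply: eq_bigl => i; rewrite inE ltn_ord.
(* The shortest prefix of mass at least t: its last candidate becomes the fractional one and
   supplies just what the shorter prefix lacks. *)
have /ex_minnP[m tm min] : exists m, t <= F m by exists n.
case: m tm min => [|m] tm min.
  exists (Ordinal n0), 0; rewrite lexx ler01; split=> //.
  by rewrite sum_prefix_vec mul0r addr0 -/(F 0%N); lra.
have mn := min _ Fn; pose j := Ordinal mn.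
have tF : F m < t by rewrite ltNge; apply/negP => /min; rewrite ltnn.
have FS : F m.+1 = p j + F m.
  by rewrite /F (prefix_setS j) big_setU1 ?prefix_set_self.
have pj : 0 < p j by lra.
exists j, ((t - F m) / p j); split.
  by rewrite divr_ge0 ?ler_pdivrMr //; lra.
by rewrite sum_prefix_vec divfK ?gt_eqF // -/(F m); lra.
Qed.

(** * The supremum defining [alpha] *)

Lemma mul_sup_le {R : realType} (E : set R) (c b : R) :
  0 <= c -> (E !=set0)%classic -> (forall x, E x -> c * x <= b) ->
  c * sup E <= b.
Proof.
rewrite le_eqVlt => /predU1P[<-|c0] E0 cE.
  by case: E0 => x /cE; rewrite !mul0r.
rewrite mulrC -ler_pdivlMr //; apply: ge_sup => // x /cE.
by rewrite ler_pdivlMr // mulrC.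
Qed.

Definition alpha_fun {R : realType} (tau : R) (k : nat) (s : R) : R :=
  s - s / tau + pois_trunc k (s * k%:R) / (tau * k%:R).

(** Attainment provides one s that works exactly, rather than up to an error; the value 0 at s = 0
    gives the sign. *)
Lemma alpha_attained {R : realType} (tau : R) (k : nat) :
  exists s : R, [/\ 0 <= s <= 1, alpha tau k = alpha_fun tau k s
    & 0 <= alpha_fun tau k s].
Proof.
have cont : continuous (alpha_fun tau k).
  move=> s; apply: cvgD.
    by apply: cvgB; [exact: cvg_id|apply: cvgMr_tmp; exact: cvg_id].
  apply: cvgMr_tmp.
  apply: (@continuous_comp _ _ _ (fun s : R => s * k%:R) (pois_trunc k)).
    by apply: cvgMr_tmp; exact: cvg_id.
  exact: (is_derive_continuous _ _ (is_derive_pois_trunc k)).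
have [|s s01 smax] := @EVT_max R (alpha_fun tau k) 0 1 ler01.
  exact: continuous_subspaceT.
exists s; split; first by rewrite in_itv in s01.
- apply/eqP; rewrite eq_le; apply/andP; split.
    apply: ge_sup; first by exists (alpha_fun tau k 0), 0;
      rewrite /= ?lexx ?ler01 // E_min_poisE.
    by move=> _ [t /= t01 <-]; rewrite E_min_poisE; apply: smax; rewrite in_itv.
  apply: ub_le_sup.
    exists (alpha_fun tau k s) => _ [t /= t01 <-]; rewrite E_min_poisE.
    by apply: smax; rewrite in_itv.
  by exists s; rewrite /= ?E_min_poisE //; rewrite in_itv in s01.
- have <- : alpha_fun tau k 0 = 0.
    by rewrite /alpha_fun !mul0r pois_trunc0 mul0r subr0 addr0.
  by apply: smax; rewrite in_itv /= lexx ler01.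
Qed.

(** * The scaled prefix against an arbitrary feasible LP point *)

Lemma alg_mass_itv {R : realType} {n : nat} (k : nat) (p v : 'I_n -> R) :
  (forall i, 0 <= p i <= 1) -> 0 <= alg_mass k p v <= \sum_i p i.
Proof.
move=> p01; rewrite /alg_mass.
have P0 (P : pred 'I_n) : 0 <= \sum_(i | P i) p i.
  by apply: sumr_ge0 => i _; case/andP: (p01 i).
case: ifP => _; first by rewrite le_min ler0n P0 ge_min lexx orbT.
by rewrite P0 sum_mem_le.
Qed.

Lemma LP_value_le_low {R : realType} {n : nat} (k : nat) (p v : 'I_n -> R)
    (j : 'I_n) (theta s : R) (yz : ('I_n -> R) * R) :
  (forall i, 0 <= p i <= 1) ->
  (forall i i' : 'I_n, (i <= i')%N -> v i' <= v i) -> (forall i, 0 <= v i) ->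
  0 <= s <= 1 -> \sum_(i | v i > 1) p i <= k%:R ->
  \sum_i p i * prefix_vec j theta i = s * Num.min k%:R (\sum_i p i) ->
  LP_feasible k p yz ->
  s * (\sum_i v i * p i * yz.1 i + yz.2)
  <= \sum_i v i * p i * prefix_vec j theta i.
Proof.
move=> p01 vdec v0 /andP[s0 s1] hk mass [y01 zk z0].
case: yz y01 zk z0 => y z /= y01 zk z0.
have pge0 i : 0 <= p i by case/andP: (p01 i).
have y0 i : 0 <= y i by case/andP: (y01 i).
have y1 i : y i <= 1 by case/andP: (y01 i).
have spy i : 0 <= s * (p i * y i) <= p i.
  have := mulr_ge0 (pge0 i) (y0 i).
  have : p i * y i <= p i by rewrite ler_piMr.
  move=> *; rewrite mulr_ge0 //=; nra.
have Y : \sum_i p i * y i <= \sum_i p i.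
  by apply: ler_sum => i _; rewrite ler_piMr.
(* If v_j <= 1, exchange against s p y prices the mass difference at v_j in [0, 1], and z is at most
   that price per unit of s. If v_j > 1, the exchange is run on the excess over 1. *)
have [vj|vj] := leP (v j) 1.
  have := prefix_vec_exchange v p (fun i => s * (p i * y i)) j theta vdec spy.
  rewrite mass -mulr_sumr.
  have -> : \sum_i v i * (s * (p i * y i)) = s * \sum_i v i * p i * y i.
    by rewrite mulr_sumr; apply: eq_bigr => i _; ring.
  apply: le_trans; rewrite mulrDr lerD2l -mulrBr mulrCA ler_wpM2l //.
  have := v0 j.
  case: (leP k%:R (\sum_i p i)) => _ vj0; last by nra.
  by have [|] := leP (\sum_i p i * y i) k%:R; nra.
pose w i := Num.max (v i - 1) 0.
have wdec (i i' : 'I_n) : (i <= i')%N -> w i' <= w i.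
  by move=> ii'; rewrite /w ge_max !le_max lerD2r (vdec _ _ ii') lexx orbT.
pose x i := if 1 < v i then s * (p i * y i) else 0.
have xp i : 0 <= x i <= p i by rewrite /x; case: ifP; rewrite ?lexx ?pge0.
have := prefix_vec_exchange w p x j theta wdec xp.
have wj0 : 0 <= w j by rewrite /w le_max lexx orbT.
have mk : Num.min k%:R (\sum_i p i) >= \sum_(i | 1 < v i) p i.
  by rewrite le_min hk sum_mem_le.
have xm : \sum_i x i <= s * Num.min k%:R (\sum_i p i).
  apply: le_trans (ler_wpM2l s0 mk); rewrite mulr_sumr [leRHS]big_mkcond.
  apply: ler_sum => i _; rewrite /x; case: ifP => // _.
  by rewrite ler_wpM2l // ler_piMr.
have -> : \sum_i w i * p i * prefix_vec j theta i =
    \sum_i v i * p i * prefix_vec j theta i - s * Num.min k%:R (\sum_i p i).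
  (* All candidates up to j have value at least v_j > 1, so on the prefix the excess is exactly v_i
     - 1. *)
  rewrite -mass -sumrB; apply: eq_bigr => i _.
  rewrite /prefix_vec; case: ltnP => [ij|ij].
    have vij := vdec i j (ltnW ij).
    by rewrite /w (max_idPl _) ?subr_ge0; [ring|lra].
  case: eqP => [->|_]; last by rewrite !mulr0 subrr.
  by rewrite /w (max_idPl _) ?subr_ge0; [ring|lra].
have wx : s * (\sum_i v i * p i * y i - \sum_i p i * y i) <= \sum_i w i * x i.
  rewrite -sumrB mulr_sumr; apply: ler_sum => i _.
  have sp := mulr_ge0 s0 (mulr_ge0 (pge0 i) (y0 i)).
  rewrite /x /w; case: ifP => vi.
    by rewrite (max_idPl _) ?subr_ge0 ?(ltW vi) //; lra.
  have vi1 : v i <= 1 by rewrite leNgt vi.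
  by rewrite mulr0; nra.
rewrite -subr_ge0 in xm.
rewrite mass; have := mulr_ge0 wj0 xm => h1 h2.
have zm : s * z <= s * (Num.min k%:R (\sum_i p i) - \sum_i p i * y i).
  by rewrite ler_wpM2l //; case: (leP k%:R (\sum_i p i)) => _; lra.
lra.
Qed.

(** With D = s - g(s k) / k >= 0, [alpha_fun] equals s - D / tau. Replacing D / tau by 0 or by D
    only increases it, giving s and g(s k) / k. *)
Lemma alpha_fun_bounds {R : realType} (tau : R) (k : nat) (s : R) :
  0 < tau < 1 -> (0 < k)%N -> 0 <= s ->
  alpha_fun tau k s <= s /\
  alpha_fun tau k s * k%:R <= pois_trunc k (s * k%:R).
Proof.
move=> /andP[t0 t1] k0 s0; have K0 : 0 < k%:R :> R by rewrite ltr0n.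
have := pois_trunc_le_id k (s * k%:R) (mulr_ge0 s0 (ltW K0)).
rewrite /alpha_fun; set G := pois_trunc _ _ => Gs.
have e : s - s / tau + G / (tau * k%:R) = s - (s * k%:R - G) / k%:R / tau.
  by field; rewrite !gt_eqF.
have D0 : 0 <= (s * k%:R - G) / k%:R by rewrite divr_ge0 ?subr_ge0 // ltW.
have D1 : (s * k%:R - G) / k%:R <= (s * k%:R - G) / k%:R / tau.
  by rewrite ler_pdivlMr // ler_piMr // ltW.
split; first by rewrite e lerBlDr lerDl divr_ge0 // ltW.
rewrite -ler_pdivlMr // e.
have -> : G / k%:R = s - (s * k%:R - G) / k%:R by field; rewrite gt_eqF.
by rewrite lerD2l lerN2.
Qed.

Lemma alg_ge {R : realType} {n : nat} (k : nat) (tau s : R) (p v : 'I_n -> R)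
    (j : 'I_n) (theta : R) (yz : ('I_n -> R) * R) :
  0 < tau < 1 -> (0 < k)%N -> (forall i, 0 <= p i <= 1) ->
  (forall i i' : 'I_n, (i <= i')%N -> v i' <= v i) -> (forall i, tau <= v i) ->
  0 <= s <= 1 -> 0 <= alpha_fun tau k s -> 0 <= theta <= 1 ->
  \sum_i p i * prefix_vec j theta i = s * alg_mass k p v ->
  LP_feasible k p yz ->
  alpha_fun tau k s * (\sum_i v i * p i * yz.1 i + yz.2)
  <= policy_reward k p v (indep_policy (prefix_vec j theta)).
Proof.
move=> tau01 k0 p01 vdec vt s01 c0 theta01 mass feas.
have /andP[t0 t1] := tau01; have /andP[s0 s1] := s01.
have pge0 i : 0 <= p i by case/andP: (p01 i).
have v0 i : 0 <= v i by apply: le_trans (vt i); exact: ltW.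
have K0 : 0 < k%:R :> R by rewrite ltr0n.
have /andP[M0 Mp] := alg_mass_itv k p v p01.
have q0 i : 0 <= prefix_vec j theta i.
  by case/andP: (prefix_vec_itv j theta i theta01).
have [cs cG] := alpha_fun_bounds tau k s tau01 k0 s0.
apply: le_trans (policy_reward_prefix_vec_ge k p v j theta p01 theta01).
rewrite mass.
have -> : \sum_i (v i - 1) * p i * prefix_vec j theta i =
    \sum_i v i * p i * prefix_vec j theta i - s * alg_mass k p v.
  by rewrite -mass -sumrB; apply: eq_bigr => i _; ring.
have Qtau : tau * (s * alg_mass k p v)
    <= \sum_i v i * p i * prefix_vec j theta i.
  rewrite -mass mulr_sumr; apply: ler_sum => i _.
  by rewrite -mulrA ler_wpM2r // mulr_ge0.
move: mass Qtau M0 Mp; rewrite /alg_mass; case: ifP => hk.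
- set M := Num.min _ _ => mass Qtau M0 Mp.
  have Mk : M <= k%:R by rewrite ge_min lexx.
  have := LP_value_le_low k p v j theta s yz p01 vdec v0 s01 hk mass feas.
  move: Qtau; set Q := \sum_i v i * p i * _; set val := _ + yz.2 => Qtau sQ.
  (* Division by s requires s > 0; at s = 0 the factor [alpha_fun] is squeezed to 0. *)
  move: s0; rewrite le_eqVlt => /predU1P[s00|s0].
    have -> : alpha_fun tau k s = 0 by apply/eqP; rewrite eq_le c0 s00 cs.
    by rewrite -s00 !mul0r pois_trunc0 subr0 addr0; nra.
  have valV : val <= Q / s by rewrite ler_pdivlMr // mulrC.
  have VM : M <= Q / s / tau by rewrite !ler_pdivlMr //; lra.
  apply: le_trans (ler_wpM2l c0 valV) _.
  have sk0 : 0 <= s * k%:R by rewrite mulr_ge0 // ltW.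
  have Gs := pois_trunc_le_id k _ sk0.
  have Mk01 : 0 <= M / k%:R <= 1.
    by rewrite divr_ge0 ?(ltW K0) //= ler_pdivrMr // mul1r.
  have := pois_trunc_scale k _ _ Mk01 sk0.
  have -> : M / k%:R * (s * k%:R) = s * M by field; rewrite gt_eqF.
  rewrite /alpha_fun; set G := pois_trunc k (s * k%:R) => gM.
  have D0 : 0 <= (s * k%:R - G) / k%:R by rewrite divr_ge0 ?subr_ge0 // ltW.
  have := ler_wpM2l D0 VM.
  (* With D = (s k - G) / k, the left side is Q - D Q / (s tau). Since M <= Q / (s tau), it is at
     most Q - D M = Q - s M + (M / k) G, and [gM] concludes. *)
  have -> : (s - s / tau + G / (tau * k%:R)) * (Q / s) =
      Q - (s * k%:R - G) / k%:R * (Q / s / tau).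
    by field; rewrite !gt_eqF.
  have -> : (s * k%:R - G) / k%:R * M = s * M - M / k%:R * G.
    by field; rewrite gt_eqF.
  by lra.
- set M := \sum_(i | 1 < v i) _ => mass Qtau M0 Mp.
  have kM : k%:R <= M by apply: ltW; rewrite ltNge /M hk.
  pose W := \sum_(i | 1 < v i) (v i - 1) * p i.
  have W0 : 0 <= W.
    by apply: sumr_ge0 => i vi; rewrite mulr_ge0 // subr_ge0 ltW.
  have valW : \sum_i v i * p i * yz.1 i + yz.2 <= W + k%:R.
    case: yz feas => y z [/= y01 zk _].
    suff : \sum_i v i * p i * y i - \sum_i p i * y i <= W by lra.
    rewrite -sumrB /W [leRHS]big_mkcond; apply: ler_sum => i _ /=.
    have /andP[y0 y1] := y01 i; have pi0 := pge0 i.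
    have -> : v i * p i * y i - p i * y i = (v i - 1) * p i * y i by ring.
    case: ltP => vi; first by rewrite ler_piMr // mulr_ge0 // subr_ge0 ltW.
    by rewrite -mulrA mulr_le0_ge0 ?mulr_ge0 // subr_le0.
  have QW : s * W <= \sum_i v i * p i * prefix_vec j theta i - s * M.
    (* This comparison vector has total mass exactly s M, so the v_j term of the exchange
       vanishes. *)
    pose x i := if 1 < v i then s * p i else 0.
    have xp i : 0 <= x i <= p i.
      rewrite /x; case: ifP => _; last by rewrite lexx pge0.
      by rewrite mulr_ge0 // ler_piMl.
    have := prefix_vec_exchange v p x j theta vdec xp.
    have -> : \sum_i x i = s * M.
      by rewrite /M [in RHS]big_mkcond mulr_sumr; apply: eq_bigr => i _;
        rewrite /x; case: ifP; rewrite ?mulr0.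
    have -> : \sum_i v i * x i = s * (W + M).
      rewrite /W /M -big_split [in RHS]big_mkcond mulr_sumr /=.
      by apply: eq_bigr => i _; rewrite /x; case: ifP => _; ring.
    by rewrite mass subrr mulr0; lra.
  have gM : pois_trunc k (s * k%:R) <= pois_trunc k (s * M).
    by apply: pois_trunc_ndecr; rewrite ?ler_wpM2l // mulr_ge0 // ltW.
  (* The W part uses that [alpha_fun] is at most s, the k part that [alpha_fun] times k is at most
     g(s k). *)
  have := ler_wpM2l c0 valW; have := ler_wpM2r W0 cs; lra.
Qed.

(** * The LP as an upper bound on every policy *)

Lemma LP_has_ubound {R : realType} {n : nat} (k : nat) (p v : 'I_n -> R) :
  (forall i, 0 <= p i <= 1) -> (forall i, 0 <= v i) ->
  has_ubound ([set \sum_i v i * p i * yz.1 i + yz.2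
    | yz in LP_feasible k p])%classic.
Proof.
move=> p01 v0; exists (\sum_i v i * p i) => _ [[y z] [/= y01 _ z0] <-].
rewrite -[leRHS]addr0 lerD //; apply: ler_sum => i _.
have /andP[pi0 _] := p01 i; have /andP[_ y1] := y01 i.
by rewrite ler_piMr // mulr_ge0.
Qed.

Lemma reward_set_le_LP {R : realType} {n : nat} (k : nat) (p v : 'I_n -> R)
    (S : {set 'I_n}) :
  (forall i, 0 <= p i <= 1) -> (forall i, 0 <= v i) ->
  reward_set k p v S <= LP_sim k p v.
Proof.
move=> p01 v0; apply: ub_le_sup; first exact: LP_has_ubound.
have e (w : 'I_n -> R) :
    \sum_i w i * (if i \in S then 1 else 0) = \sum_(i in S) w i.
  rewrite [RHS]big_mkcond; apply: eq_bigr => i _.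
  by case: ifP; rewrite ?mulr1 ?mulr0.
(* Here z is minus the expected number of acceptances beyond k; it is feasible because E[min(X, k)]
   is at most both k and E[X]. *)
exists ((fun i => if i \in S then 1 else 0), acc_min p k S - \sum_(i in S) p i).
  split=> /=.
  - by move=> i; case: ifP; rewrite ?lexx ?ler01.
  - by rewrite e lerD2r acc_min_le.
  - by rewrite subr_le0 acc_min_le_sum.
rewrite /= e reward_setE addrCA addrC -sumrB; congr (_ + _).
by apply: eq_bigr => i _; ring.
Qed.

Lemma OPT_le_LP {R : realType} {n : nat} (k : nat) (p v : 'I_n -> R) :
  (forall i, 0 <= p i <= 1) -> (forall i, 0 <= v i) ->
  OPT_sim k p v <= LP_sim k p v.
Proof.
move=> p01 v0; apply: ge_sup => [|_ [pi [pi0 pi1] <-]].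
  (* Nonemptiness of the set of policies is witnessed by making no offers. *)
  pose pi0 (S : {set 'I_n}) : R := (S == set0)%:R.
  exists (policy_reward k p v pi0), pi0 => //; split=> [S|]; first exact: ler0n.
  rewrite (bigD1 set0) //= big1 => [|S /negbTE S0];
    by rewrite /pi0 ?eqxx ?addr0 ?S0.
rewrite -[leRHS]mul1r -pi1 mulr_suml; apply: ler_sum => S _.
by rewrite ler_wpM2l // reward_set_le_LP.
Qed.

Theorem theorem6p1 (R : realType) (n k : nat) (tau : R) (p v : 'I_n -> R) :
  0 < tau < 1 -> (1 <= k)%N -> (k <= n)%N ->
  (forall i, 0 <= p i <= 1) ->
  (forall i j : 'I_n, (i <= j)%N -> v j <= v i) ->
  (forall i, tau <= v i) ->
  (exists s : R, 0 <= s <= 1 /\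
     forall y' : 'I_n -> R, alg_vector k p v s y' ->
       policy_reward k p v (indep_policy y') >= alpha tau k * LP_sim k p v)
  /\
  (exists m : nat, (m <= n)%N /\
     reward_set k p v (prefix_set n m) >= alpha tau k * OPT_sim k p v).
Proof.
move=> tau01 k1 kn p01 vdec vt; have /andP[t0 _] := tau01.
have v0 i : 0 <= v i by apply: le_trans (vt i); exact: ltW.
have [s [s01 -> a0]] := alpha_attained tau k.
have LPne : ([set \sum_i v i * p i * yz.1 i + yz.2
    | yz in LP_feasible k p] !=set0)%classic.
  exists (\sum_i v i * p i * 0 + 0), ((fun=> 0), 0) => //; split=> //=.
    by move=> i; rewrite lexx ler01.
  by rewrite big1 ?subr0 // => i _; rewrite mulr0.
have alg (j : 'I_n) (theta : R) : 0 <= theta <= 1 ->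
    \sum_i p i * prefix_vec j theta i = s * alg_mass k p v ->
    alpha_fun tau k s * LP_sim k p v
    <= policy_reward k p v (indep_policy (prefix_vec j theta)).
  move=> theta01 mass; apply: mul_sup_le => // _ [yz feas <-].
  exact: (alg_ge k tau s).
split.
  exists s; split=> // y' [/prefix_formP[j [theta [theta01 ->]]] mass].
  by apply: alg => //; rewrite -mass; apply: eq_bigr => i _; rewrite mulrC.
have /andP[M0 Mp] := alg_mass_itv k p v p01.
have /andP[s0 s1] := s01.
have sM : 0 <= s * alg_mass k p v <= \sum_i p i.
  by rewrite mulr_ge0 //=; apply: le_trans Mp; rewrite ler_piMl.
have [j [theta [theta01 mass]]] :=
  prefix_vec_exists p _ (leq_trans k1 kn) sM.
have := le_trans (ler_wpM2l a0 (OPT_le_LP k p v p01 v0))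
  (alg j theta theta01 mass).
rewrite policy_reward_prefix_vec; case/andP: theta01 => th0 th1.
set b := _ * OPT_sim _ _ _ => bmix.
(* A mixture of two prefix rewards reaches b, so one of them does; if the shorter prefix fails,
   theta > 0 and the longer one succeeds. *)
have [h|h] := leP b (reward_set k p v (prefix_set n j)).
  by exists j; rewrite (ltnW (ltn_ord j)).
exists j.+1; split; first exact: ltn_ord.
have th_gt0 : 0 < theta.
  by rewrite lt_neqAle th0 andbT; apply/eqP => e; rewrite -e in bmix; lra.
by rewrite -(ler_pM2l th_gt0); nra.
Qed.
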